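(* Let $n\ge1$ and let $\mathfrak s=\operatorname{span}_{\mathbb R}\{x_k,y_k,z\}_{k=1}^n\subset\mathfrak{sp}_{2n+2}(\mathbb R)$, where $$x_k=\begin{pmatrix}E_{1,k+1}&0\\0&-E_{k+1,1}\end{pmatrix},\qquad y_k=\begin{pmatrix}0&E_{1,k+1}+E_{k+1,1}\\0&0\end{pmatrix},\qquad z=\begin{pmatrix}0&2E_{11}\\0&0\end{pmatrix},$$ so that $\mathfrak s\cong\mathfrak{hw}_n$ via $P_k\mapsto x_k$, $Q_k\mapsto y_k$, $Z\mapsto z$. Then every finite-dimensional complex irreducible representation of $\mathfrak{sp}_{2n+2}(\mathbb R)$ remains indecomposable upon restriction to $\mathfrak s$. Equivalently, with $\mathfrak s_T=\mathfrak s\otimes_{\mathbb R}\mathbb C=\bigoplus_{\alpha\in T}\mathbb CX_\alpha$, $T=\{\varepsilon_1-\varepsilon_k,\varepsilon_1+\varepsilon_k\}_{k=2}^{n+1}\cup\{2\varepsilon_1\}$, every finite-dimensional irreducible representation of $\mathfrak{sp}_{2n+2}(\mathbb C)$ remains indecomposable upon restriction to $\mathfrak s_T$. *)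

(* Defs.v *)
From HB Require Import structures.
From mathcomp Require Import all_boot all_order all_algebra.
From mathcomp Require Import complex.
From mathcomp Require Import Rstruct.
From Stdlib Require Rdefinitions.
Set Implicit Arguments. Unset Strict Implicit. Unset Printing Implicit Defensive.
Import Order.TTheory GRing.Theory Num.Theory.
Local Open Scope ring_scope.

Notation RR := Rdefinitions.R.
Notation CC := (complex Rdefinitions.R).

Notation Mat n := 'M[RR]_(n.+1 + n.+1).

Definition Jsp n : Mat n := block_mx 0 1%:M (- 1%:M) 0.
Definition in_sp n (X : Mat n) : Prop := X^T *m Jsp n + Jsp n *m X = 0.

Definition lie_br m (A B : 'M[CC]_m) : 'M[CC]_m := A *m B - B *m A.
Definition lie_brR n (X Y : Mat n) : Mat n := X *m Y - Y *m X.

(* E_{1,k+1} inside (n+1)x(n+1), for k : 'I_n standing for k+1 in {1..n}. *)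
Definition Ek1 n (k : 'I_n) : 'M[RR]_n.+1 := delta_mx ord0 (lift ord0 k).
Definition E1k n (k : 'I_n) : 'M[RR]_n.+1 := delta_mx (lift ord0 k) ord0.

Definition xk n (k : 'I_n) : Mat n := block_mx (Ek1 k) 0 0 (- E1k k).
Definition yk n (k : 'I_n) : Mat n := block_mx 0 (Ek1 k + E1k k) 0 0.
Definition zz n : Mat n := block_mx 0 (2%:R *: delta_mx ord0 ord0) 0 0.

Definition in_s n (X : Mat n) : Prop :=
  exists (a b : 'I_n -> RR) (c : RR),
    X = \sum_(k < n) (a k *: xk k + b k *: yk k) + c *: zz n.

Definition is_sp_rep n m (rho : Mat n -> 'M[CC]_m) : Prop :=
  (forall (a : RR) X Y, in_sp X -> in_sp Y ->
     rho (a *: X + Y) = (a%:C)%C *: rho X + rho Y) /\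
  (forall X Y, in_sp X -> in_sp Y -> rho (lie_brR X Y) = lie_br (rho X) (rho Y)).

(* A subspace of C^m is encoded as the row space of U : 'M_m; its elements are the
   column vectors c with c^T in the row space of U.  It is invariant under the
   operator A (acting on column vectors c |-> A c) iff U A^T <= U. *)
Definition invariant m (U A : 'M[CC]_m) : Prop := (U *m A^T <= U)%MS.

Definition irreducible_rep n m (rho : Mat n -> 'M[CC]_m) : Prop :=
  (0 < m)%nat /\
  forall U : 'M[CC]_m, (forall X, in_sp X -> invariant U (rho X)) ->
    (U == (0 : 'M[CC]_m))%MS \/ (U == 1%:M)%MS.

Definition indecomposable_on_s n m (rho : Mat n -> 'M[CC]_m) : Prop :=
  (0 < m)%nat /\
  forall U W : 'M[CC]_m,
    (forall X, in_s X -> invariant U (rho X)) ->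
    (forall X, in_s X -> invariant W (rho X)) ->
    (U :&: W == (0 : 'M[CC]_m))%MS -> (U + W == 1%:M)%MS ->
    (U == (0 : 'M[CC]_m))%MS \/ (W == (0 : 'M[CC]_m))%MS.

(* Main.v *)
From HB Require Import structures.
Require Import Defs.
From mathcomp Require Import all_boot all_order all_algebra.
From mathcomp Require Import complex.
From mathcomp Require Import ring Rstruct.
Set Implicit Arguments. Unset Strict Implicit. Unset Printing Implicit Defensive.
Import Order.TTheory GRing.Theory Num.Theory.
Local Open Scope ring_scope.

(** A decomposition [V = U (+) W] over the Heisenberg algebra [s] gives a
    projection [P] commuting with [s].  Let [e], [h], [f] be the [sl2]-triple of
    the long root [2 eps_1], so that [e] lies in [s].  The commutant of [s] in
    [End V] is killed by [ad e] and stable under [ad h], hence [ad h] has weights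
    in [nat] on it, by [sl2]-theory.  A commutant element [A] of weight [0] is
    killed by [ad f], since [ad f A] would be a highest weight vector of weight
    [-2]; as [s] and [f] generate [sp], Schur's lemma makes [A] scalar.  So in an
    eigenbasis of [h] the projection [P] is triangular with constant diagonal
    [c]; then [c] is [0] or [1], and comparing rank and trace gives [P = 0] or
    [P = 1]. *)

(** * Commutators with a diagonal matrix, [sl2]-weights and idempotents *)

Section Commutators.
Context {F : numFieldType} {m : nat}.
Implicit Types (A B C E H Q X P : 'M[F]_m) (d : 'rV[F]_m) (mu : F).

Definition mxbr A B := A *m B - B *m A.

Lemma mxbr_eq0 A B : (mxbr A B = 0) <-> (A *m B = B *m A).
Proof. by rewrite /mxbr; split=> [/subr0_eq //|->]; rewrite subrr. Qed.

Lemma mxbrC A B : mxbr A B = - mxbr B A.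
Proof. by rewrite opprB. Qed.

Lemma mxbrZr A c B : mxbr A (c *: B) = c *: mxbr A B.
Proof. by rewrite /mxbr -scalemxAr -scalemxAl scalerBr. Qed.

Lemma mxbrZl A c B : mxbr (c *: A) B = c *: mxbr A B.
Proof. by rewrite mxbrC mxbrZr mxbrC scalerN opprK. Qed.

Lemma mxbr_jacobi A B C :
  mxbr A (mxbr B C) = mxbr (mxbr A B) C + mxbr B (mxbr A C).
Proof.
rewrite /mxbr !mulmxBr !mulmxBl !mulmxA.
move: (A *m B *m C) (A *m C *m B) (B *m C *m A) (C *m B *m A) (B *m A *m C)
  (C *m A *m B) => a b c e f g.
by apply/matrixP=> i j; rewrite !mxE; ring.
Qed.

Lemma mxbr_diag d Q i j :
  mxbr (diag_mx d) Q i j = (d 0 i - d 0 j) * Q i j.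
Proof. by rewrite /mxbr mul_diag_mx mul_mx_diag !mxE; ring. Qed.

Lemma mxbr_diagP d Q mu :
  mxbr (diag_mx d) Q = mu *: Q <->
  forall i j, Q i j != 0 -> d 0 i - d 0 j = mu.
Proof.
split=> [eQ i j Qij | dQ].
  by apply: (mulIf Qij); rewrite -mxbr_diag eQ mxE.
apply/matrixP=> i j; rewrite mxbr_diag mxE.
by have [->|/dQ ->//] := eqVneq (Q i j) 0; rewrite !mulr0.
Qed.

(** The projection of [Q] onto the [mu]-eigenspace of [ad (diag_mx d)]: the matrix unit at [(i, j)]
    has weight [d 0 i - d 0 j]. *)
Definition wtcomp d mu Q : 'M[F]_m :=
  \matrix_(i, j) (Q i j *+ (d 0 i - d 0 j == mu)).

Lemma mxbr_wtcomp d mu Q :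
  mxbr (diag_mx d) (wtcomp d mu Q) = mu *: wtcomp d mu Q.
Proof.
by apply/mxbr_diagP => i j; rewrite mxE; case: (eqVneq _ mu) => //= _; rewrite eqxx.
Qed.

(** Multiplication by [X], on either side, raises weights by [kappa]. Both products are therefore
    the component of weight [mu + kappa] of the same matrix [Q *m X = X *m Q]. *)
Lemma wtcomp_comm d kappa mu X Q :
  mxbr (diag_mx d) X = kappa *: X -> Q *m X = X *m Q ->
  wtcomp d mu Q *m X = X *m wtcomp d mu Q.
Proof.
move=> /mxbr_diagP dX QX.
pose b i j := d 0 i - d 0 j == mu + kappa.
have hl : wtcomp d mu Q *m X = \matrix_(i, j) ((Q *m X) i j *+ b i j).
  apply/matrixP=> i j; rewrite !mxE -sumrMnl; apply: eq_bigr => k _.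
  rewrite mxE; have [->|/dX dk] := eqVneq (X k j) 0.
    by rewrite !mulr0 mul0rn.
  rewrite mulrnAl /b -dk; congr (_ *+ nat_of_bool _).
  by rewrite -subr_eq0 -[RHS]subr_eq0; congr (_ == _); ring.
have hr : X *m wtcomp d mu Q = \matrix_(i, j) ((X *m Q) i j *+ b i j).
  apply/matrixP=> i j; rewrite !mxE -sumrMnl; apply: eq_bigr => k _.
  rewrite mxE; have [->|/dX dk] := eqVneq (X i k) 0.
    by rewrite !mul0r mul0rn.
  rewrite mulrnAr /b -dk; congr (_ *+ nat_of_bool _).
  by rewrite -subr_eq0 -[RHS]subr_eq0; congr (_ == _); ring.
by rewrite hl hr QX.
Qed.

(* [ad] makes square matrices a finite-dimensional [sl2]-module; its highest
   weight vectors have weights in [nat]. *)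
Lemma highest_weight_nat d E Fm Q mu :
  mxbr E Fm = diag_mx d -> mxbr (diag_mx d) Fm = - 2 *: Fm ->
  mxbr E Q = 0 -> mxbr (diag_mx d) Q = mu *: Q -> Q != 0 ->
  exists k : nat, mu = k%:R.
Proof.
move=> EF HF EQ HQ Q0.
pose q k := iter k (mxbr Fm) Q.
have qS k : q k.+1 = mxbr Fm (q k) by [].
have Hq k : mxbr (diag_mx d) (q k) = (mu - 2 * k%:R) *: q k.
  elim: k => [|k IH]; first by rewrite mulr0 subr0.
  rewrite qS mxbr_jacobi HF IH mxbrZl mxbrZr -scalerDl.
  by congr (_ *: _); rewrite -natr1; ring.
have Eq k : mxbr E (q k.+1) = (k.+1%:R * (mu - k%:R)) *: q k.
  elim: k => [|k IH].
    rewrite /= mxbr_jacobi EF HQ EQ.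
    have -> : mxbr Fm 0 = 0 by rewrite /mxbr mulmx0 mul0mx subrr.
    by rewrite addr0 mul1r subr0.
  rewrite (qS k.+1) mxbr_jacobi EF Hq IH mxbrZr -qS -scalerDl.
  by congr (_ *: _); rewrite -!natr1; ring.
(* The numbers [mu - 2 k] are pairwise distinct, and a matrix has only finitely many possible
   weights [d 0 i - d 0 j]. Some [mu - 2 k] is thus no weight, which forces [q k = 0]. *)
have [k qk0] : exists k, q k == 0.
  pose s := [seq mu - 2 * k%:R | k <- iota 0 (size (enum {: 'I_m * 'I_m})).+1].
  pose t := [seq d 0 p.1 - d 0 p.2 | p <- enum {: 'I_m * 'I_m}].
  have us : uniq s.
    rewrite map_inj_uniq ?iota_uniq // => a b /addrI /oppr_inj.
    have two0 : (2 : F) != 0 by rewrite pnatr_eq0.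
    by move=> /(mulfI two0) /eqP; rewrite eqr_nat => /eqP.
  have nst : ~ {subset s <= t}.
    by move=> /(uniq_leq_size us); rewrite !size_map size_iota ltnn.
  have /allPn[x /mapP[k _ ->] xt] : ~~ all (mem t) s by apply/negP=> /allP.
  exists k; apply: contraT => /eqP/matrixP qk; case: qk => i j; rewrite mxE.
  apply: contraNeq xt => qij; apply/mapP; exists (i, j); rewrite ?mem_enum //=.
  by rewrite (proj1 (mxbr_diagP _ _ _) (Hq k)).
(* If [q l] is the last nonzero term of the string, [Eq l] reads [0 = (l + 1) (mu - l) q l], so
   [mu = l]. *)
pose k0 := ex_minn (ex_intro (fun k => q k == 0) k qk0).
have := erefl k0; rewrite {1}/k0; case: ex_minnP => -[|l] ql lmin _.
  by rewrite ql in Q0.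
exists l; apply/eqP; rewrite -subr_eq0; move: (Eq l); rewrite (eqP ql).
rewrite {1}/mxbr mulmx0 mul0mx subrr => /esym/eqP; rewrite scaler_eq0 mulf_eq0.
rewrite pnatr_eq0 /=; case/orP=> // /lmin; by rewrite ltnn.
Qed.

(** The trace of an idempotent is its rank: in the full-rank factorization of [P], the two factors
    multiply in the other order to the identity. Characteristic zero then makes the rank vanish. *)
Lemma idempotent_trace0 P : P *m P = P -> \tr P = 0 -> P = 0.
Proof.
move=> PP tr0.
have RC : row_base P *m col_base P = 1%:M.
  apply: (row_free_inj (row_base_free P)); apply: (row_full_inj (col_base_full P)).
  by rewrite mul1mx -mulmxA mulmx_base mulmxA mulmx_base.
move: tr0; rewrite -{1}(mulmx_base P) mxtrace_mulC RC mxtrace1 => /eqP.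
by rewrite pnatr_eq0 mxrank_eq0 => /eqP.
Qed.

(** Sorting indices by [d] makes [P] block triangular with diagonal blocks [c%:M]. Hence [c] is 0 or
    1, and [P] or [1 - P] is an idempotent of trace 0. *)
Lemma idempotent_triangular d c P : (0 < m)%N -> P *m P = P ->
  (forall i j, P i j != 0 -> exists k : nat, d 0 i - d 0 j = k%:R) ->
  (forall i j, d 0 i = d 0 j -> P i j = c *+ (i == j)) ->
  P = 0 \/ P = 1%:M.
Proof.
move=> m0 PP tri diagP.
have Pii i : P i i = c by rewrite diagP // eqxx.
have trP : \tr P = c *+ m.
  by rewrite /mxtrace (eq_bigr (fun=> c)) ?sumr_const ?card_ord.
have cc : c * c = c.
  pose i := Ordinal m0.
  (* A nonzero term [P i k * P k i] with [k != i] would give two opposite weights in [nat], hence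
     [d 0 i = d 0 k], where off-diagonal entries vanish. Only [c * c] is left. *)
  have := congr1 (fun M : 'M_m => M i i) PP.
  rewrite /= mxE (bigD1 i) //= big1 ?Pii ?addr0 // => k ki.
  apply/eqP; apply: contraNT ki; rewrite mulf_eq0 negb_or => /andP[Pik Pki].
  have [a ea] := tri _ _ Pik; have [b eb] := tri _ _ Pki.
  have : a%:R + b%:R = 0 :> F by rewrite -ea -eb; ring.
  rewrite -natrD => /eqP; rewrite pnatr_eq0 addn_eq0 => /andP[/eqP a0 _].
  have dik : d 0 i = d 0 k by apply/eqP; rewrite -subr_eq0 ea a0.
  by move: Pik; rewrite diagP // [k == i]eq_sym; case: (i == k) => //; rewrite mulr0n eqxx.
have [c0|c0] := eqVneq c 0.
  by left; apply: idempotent_trace0; rewrite // trP c0 mul0rn.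
have c1 : c = 1 by apply: (mulfI c0); rewrite mulr1.
right; apply/eqP; rewrite -subr_eq0 -oppr_eq0 opprB; apply/eqP.
apply: idempotent_trace0.
  by rewrite mulmxBl !mulmxBr !mul1mx mulmx1 PP subrr subr0.
by rewrite raddfB /= trP c1 mxtrace1 subrr.
Qed.

(** Since [N] consists of weight vectors, every weight component of [P] commutes with [N] again, so
    the highest weight argument applies to each component separately. *)
Lemma idempotent_commuting d E Fm (N : 'M[F]_m -> Prop) P : (0 < m)%N ->
  mxbr E Fm = diag_mx d -> mxbr (diag_mx d) Fm = - 2 *: Fm ->
  N E -> (forall X, N X -> exists kappa, mxbr (diag_mx d) X = kappa *: X) ->
  (forall Q, (forall X, N X -> Q *m X = X *m Q) -> Q *m Fm = Fm *m Q ->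
     is_scalar_mx Q) ->
  P *m P = P -> (forall X, N X -> P *m X = X *m P) -> P = 0 \/ P = 1%:M.
Proof.
move=> m0 EF HF NE Nwt schur PP PN.
have PmuN mu X : N X -> wtcomp d mu P *m X = X *m wtcomp d mu P.
  by move=> NX; have [kappa hX] := Nwt _ NX; apply: wtcomp_comm hX (PN _ NX).
have Pnat mu : wtcomp d mu P != 0 -> exists k : nat, mu = k%:R.
  apply: highest_weight_nat EF HF _ (mxbr_wtcomp _ _ _).
  by apply/mxbr_eq0; rewrite PmuN.
pose P0 := wtcomp d 0 P.
have EP0 : mxbr E P0 = 0 by apply/mxbr_eq0; rewrite PmuN.
have HP0 : mxbr (diag_mx d) P0 = 0 by rewrite mxbr_wtcomp scale0r.
have br0 X : mxbr X 0 = 0 by rewrite /mxbr mulmx0 mul0mx subrr.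
(* [mxbr Fm P0] would be a highest weight vector of weight [-2]. *)
have FP0 : mxbr Fm P0 = 0.
  apply/eqP; apply: contraT => nz.
  have [||k] := highest_weight_nat EF HF (Q := mxbr Fm P0) (mu := - 2) _ _ nz.
  - by rewrite mxbr_jacobi EF HP0 EP0 br0 addr0.
  - by rewrite mxbr_jacobi HF HP0 br0 addr0 mxbrZl.
  by move/eqP; rewrite -subr_eq0 -opprD oppr_eq0 -natrD pnatr_eq0.
have [c Pc] : exists c, P0 = c%:M.
  apply/is_scalar_mxP/schur; first by move=> X NX; apply: PmuN.
  by apply: esym; apply/mxbr_eq0.
(* The entry [P i j] lies in the component of weight [d 0 i - d 0 j]; entries between equal weights
   are those of [P0 = c%:M]. *)
apply: (idempotent_triangular (d := d) (c := c)) => // [i j Pij|i j dij].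
  apply: Pnat; apply: contraNneq Pij => /matrixP /(_ i j).
  by rewrite !mxE eqxx mulr1n => ->.
by have /matrixP/(_ i j) := Pc; rewrite !mxE dij subrr eqxx.
Qed.

End Commutators.

(** * The symplectic Lie algebra in block form *)

Section Symplectic.
Context {n : nat}.
Implicit Types (M S T : 'M[RR]_n.+1) (X Y : Mat n) (i j : 'I_n.+1) (k : 'I_n).

(** [spA] embeds the Levi subalgebra [gl_(n+1)]; on symmetric matrices [spB] and [spC] give the two
    opposite abelian nilradicals. *)
Definition spA M : Mat n := block_mx M 0 0 (- M^T).
Definition spB S : Mat n := block_mx 0 S 0 0.
Definition spC S : Mat n := block_mx 0 0 S 0.

Local Notation dE := (delta_mx : 'I_n.+1 -> 'I_n.+1 -> 'M[RR]_n.+1).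
Local Notation E00 := (dE ord0 ord0).

(* The [sl2]-triple of the long root [2 eps_1]; [zz n] is [2 sl2_e]. *)
Definition sl2_e : Mat n := spB E00.
Definition sl2_f : Mat n := spC E00.
Definition sl2_h : Mat n := spA E00.

Definition lie_closed (P : Mat n -> Prop) :=
  (forall a X Y, P X -> P Y -> P (a *: X + Y)) /\
  (forall X Y, P X -> P Y -> P (lie_brR X Y)).

Definition symE i j := dE i j + dE j i.

Let blkE := (mulmx_block, mulmx0, mul0mx, addr0, add0r).

Lemma spA_linear a M N : spA (a *: M + N) = a *: spA M + spA N.
Proof.
rewrite /spA scale_block_mx add_block_mx !scaler0 !addr0.
by rewrite linearD linearZ /= opprD scalerN.
Qed.

Lemma spB_linear a S T : spB (a *: S + T) = a *: spB S + spB T.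
Proof. by rewrite /spB scale_block_mx add_block_mx !scaler0 !addr0. Qed.

Lemma spC_linear a S T : spC (a *: S + T) = a *: spC S + spC T.
Proof. by rewrite /spC scale_block_mx add_block_mx !scaler0 !addr0. Qed.

Lemma brAA M N : lie_brR (spA M) (spA N) = spA (M *m N - N *m M).
Proof.
rewrite /lie_brR /spA !blkE opp_block_mx add_block_mx !mulNmx !mulmxN !opprK.
by rewrite !subrr [(_ - _)^T]linearB /= !trmx_mul opprB.
Qed.

Lemma brAB M S : lie_brR (spA M) (spB S) = spB (M *m S + S *m M^T).
Proof.
rewrite /lie_brR /spA /spB !blkE opp_block_mx add_block_mx !mulmxN !opprK.
by rewrite !subrr.
Qed.

Lemma brAC M S : lie_brR (spA M) (spC S) = spC (- (M^T *m S + S *m M)).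
Proof.
rewrite /lie_brR /spA /spC !blkE opp_block_mx add_block_mx !mulNmx.
by rewrite !subrr opprD.
Qed.

Lemma brBC S T : S^T = S -> T^T = T -> lie_brR (spB S) (spC T) = spA (S *m T).
Proof.
move=> sS sT.
rewrite /lie_brR /spA /spB /spC !blkE opp_block_mx add_block_mx !oppr0.
by rewrite trmx_mul sS sT !addr0 add0r.
Qed.

Lemma xkE k : xk k = spA (dE ord0 (lift ord0 k)).
Proof. by rewrite /spA trmx_delta. Qed.

Lemma ykE k : yk k = spB (symE ord0 (lift ord0 k)).
Proof. by []. Qed.

Lemma zzE : zz n = 2 *: sl2_e.
Proof. by rewrite /sl2_e /spB scale_block_mx !scaler0. Qed.

Lemma tr_symE i j : (symE i j)^T = symE i j.
Proof. by rewrite /symE linearD /= !trmx_delta addrC. Qed.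

Lemma mul_delta i j (k l : 'I_n.+1) : dE i j *m dE k l = (j == k)%:R *: dE i l.
Proof. by rewrite mul_delta_mx_cond; case: eqP; rewrite ?scale1r ?scale0r. Qed.

Lemma sl2_ef : lie_brR sl2_e sl2_f = sl2_h.
Proof. by rewrite brBC ?trmx_delta // mul_delta eqxx scale1r. Qed.

Lemma sl2_hf : lie_brR sl2_h sl2_f = - 2 *: sl2_f.
Proof.
rewrite brAC trmx_delta mul_delta eqxx scale1r -mulr2n -scaler_nat -scaleNr.
by rewrite -[X in spC X]addr0 spC_linear /spC block_mx0 addr0.
Qed.

Lemma sl2_he : lie_brR sl2_h sl2_e = 2 *: sl2_e.
Proof.
rewrite brAB trmx_delta mul_delta eqxx scale1r -mulr2n -scaler_nat.
by rewrite -[X in spB X]addr0 spB_linear /spB block_mx0 addr0.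
Qed.

Lemma sl2_hx k : lie_brR sl2_h (xk k) = xk k.
Proof.
rewrite xkE brAA !mul_delta eqxx scale1r eq_sym (negPf (neq_lift _ _)).
by rewrite scale0r subr0.
Qed.

Lemma sl2_hy k : lie_brR sl2_h (yk k) = yk k.
Proof.
rewrite ykE brAB trmx_delta mulmxDl mulmxDr !mul_delta eqxx !scale1r.
by rewrite (negPf (neq_lift _ _)) eq_sym (negPf (neq_lift _ _)) !scale0r addr0 add0r.
Qed.

Lemma in_sp_block M S T N :
  in_sp (block_mx M S T N) <-> [/\ N = - M^T, S^T = S & T^T = T].
Proof.
rewrite /in_sp /Jsp tr_block_mx !blkE !mulmxN !mulNmx !mulmx1 !mul1mx add_block_mx.
rewrite -[0 in RHS]block_mx0; split.
  case/eq_block_mx => /eqP eT /eqP eN _ /eqP eS; split; apply/eqP.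
  - by rewrite -addr_eq0 addrC.
  - by rewrite -subr_eq0.
  - by rewrite eq_sym -subr_eq0 addrC.
case=> -> -> ->; rewrite addNr subrr linearN /= trmxK opprK subrr.
by rewrite subrr.
Qed.

Lemma in_sp_A M : in_sp (spA M).
Proof. by apply/in_sp_block; rewrite trmx0. Qed.

Lemma in_sp_B S : S^T = S -> in_sp (spB S).
Proof. by move=> sS; apply/in_sp_block; rewrite !trmx0 oppr0. Qed.

Lemma in_sp_C S : S^T = S -> in_sp (spC S).
Proof. by move=> sS; apply/in_sp_block; rewrite !trmx0 oppr0. Qed.

Lemma in_sp_e : in_sp sl2_e. Proof. by apply: in_sp_B; rewrite trmx_delta. Qed.
Lemma in_sp_f : in_sp sl2_f. Proof. by apply: in_sp_C; rewrite trmx_delta. Qed.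
Lemma in_sp_h : in_sp sl2_h. Proof. exact: in_sp_A. Qed.
Lemma in_sp_x k : in_sp (xk k). Proof. by rewrite xkE; apply: in_sp_A. Qed.
Lemma in_sp_y k : in_sp (yk k). Proof. by rewrite ykE; apply/in_sp_B/tr_symE. Qed.

Lemma in_sp_lie_closed : lie_closed (@in_sp n).
Proof.
split=> [a X Y|X Y]; rewrite /in_sp => hX hY.
  rewrite linearP /= mulmxDl mulmxDr -scalemxAl -scalemxAr addrACA -scalerDr.
  by rewrite hX hY scaler0 addr0.
move/eqP: hX; move/eqP: hY; rewrite !addr_eq0 => /eqP hY /eqP hX.
rewrite /lie_brR linearB /= !trmx_mul mulmxBl mulmxBr -!mulmxA hX hY !mulmxN.
rewrite !mulmxA hX hY !mulNmx !opprK -!mulmxA.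
by rewrite addrC subrKA subrr.
Qed.

(** * Generation of [sp] by [s] and the lowering vector [sl2_f] *)

Section Generation.
Variable P : Mat n -> Prop.
Hypothesis closedP : lie_closed P.

Let P0 X : P X -> P 0.
Proof. by move=> PX; rewrite -(addNr X) -scaleN1r; apply: closedP.1. Qed.

Let PZ a X : P X -> P (a *: X).
Proof. by move=> PX; rewrite -[_ *: _]addr0; apply: closedP.1 => //; apply: P0 PX. Qed.

Let PD X Y : P X -> P Y -> P (X + Y).
Proof. by move=> PX PY; rewrite -[X]scale1r; apply: closedP.1. Qed.

Let Psum (G : 'I_n.+1 -> Mat n) : (forall i, P (G i)) -> P (\sum_i G i).
Proof. by move=> PG; apply: (big_ind P) => //; apply: P0 (PG ord0). Qed.

Hypothesis Px : forall k, P (xk k).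
Hypothesis Py : forall k, P (yk k).
Hypothesis Pe : P sl2_e.
Hypothesis Pf : P sl2_f.

Let PA00 : P sl2_h. Proof. by rewrite -sl2_ef; apply: closedP.2. Qed.

Let PA0 i : P (spA (dE ord0 i)).
Proof. by case: (unliftP ord0 i) => [k|] -> //; rewrite -xkE. Qed.

Let PAi0 i : P (spA (dE i ord0)).
Proof.
case: (unliftP ord0 i) => [k|] -> //.
have := closedP.2 _ _ (Py k) Pf.
rewrite ykE brBC ?tr_symE ?trmx_delta // mulmxDl !mul_delta eqxx scale1r.
by rewrite eq_sym (negPf (neq_lift _ _)) scale0r add0r.
Qed.

Let PAij i j : P (spA (dE i j)).
Proof.
(* The bracket is [dE i j] up to a multiple of [E00] when [i = j]; that multiple is absorbed by
   [sl2_h]. *)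
have := closedP.2 _ _ (PAi0 i) (PA0 j); rewrite brAA !mul_delta eqxx scale1r => h.
have -> : dE i j = (j == i)%:R *: E00 + (dE i j - (j == i)%:R *: E00).
  by rewrite addrC subrK.
by rewrite spA_linear; apply: closedP.1.
Qed.

Let PA M : P (spA M).
Proof.
have -> : spA M = \sum_i \sum_j M i j *: spA (dE i j).
  rewrite [in LHS](matrix_sum_delta M).
  pose L : {linear 'M[RR]_n.+1 -> Mat n} := HB.pack spA
    (GRing.isLinear.Build _ _ _ _ spA spA_linear).
  rewrite -[spA _]/(L _) linear_sum; apply: eq_bigr => i _.
  by rewrite linear_sum; apply: eq_bigr => j _; rewrite linearZ.
by apply: Psum => i; apply: Psum => j; apply: PZ.
Qed.

(* Both [spB] and [spC] of symmetric matrices form the module [Sym^2] under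
   [M . S = M S + S M^T], generated by [E00]. *)
Let Psym (G : 'M[RR]_n.+1 -> Mat n) S :
  (forall a S T, G (a *: S + T) = a *: G S + G T) ->
  (forall M S, P (G S) -> P (G (M *m S + S *m M^T))) ->
  P (G E00) -> S^T = S -> P (G S).
Proof.
move=> linG actG G00 symS.
pose L : {linear 'M[RR]_n.+1 -> Mat n} := HB.pack G
  (GRing.isLinear.Build _ _ _ _ G linG).
have Gi0 i : P (G (symE i ord0)).
  by have := actG (dE i ord0) _ G00; rewrite trmx_delta !mul_delta eqxx !scale1r.
have Gij i j : P (G (symE i j)).
  (* [dE i ord0] sends [symE j ord0] to [symE i j], plus an extra [symE i ord0] when [j = ord0],
     which is subtracted. *)
  have := actG (dE i ord0) _ (Gi0 j).
  rewrite trmx_delta mulmxDl mulmxDr !mul_delta eqxx !scale1r => h.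
  have -> : symE i j = - (ord0 == j)%:R *: symE i ord0 +
      ((ord0 == j)%:R *: dE i ord0 + dE i j +
       (dE j i + (j == ord0)%:R *: dE ord0 i)).
    rewrite /symE [j == _]eq_sym scaleNr scalerDr.
    by apply/matrixP=> a b; rewrite !mxE; ring.
  by rewrite linG; apply: closedP.1.
(* The double sum is [S + S^T], that is, [2 S]. *)
have -> : S = 2^-1 *: \sum_i \sum_j S i j *: symE i j.
  apply: (scalerI (a := 2)); first by rewrite pnatr_eq0.
  rewrite scalerA divff ?pnatr_eq0 // scale1r scaler_nat mulr2n.
  rewrite (eq_bigr (fun i => \sum_j S i j *: dE i j + \sum_j S i j *: dE j i)).
    rewrite big_split /= -matrix_sum_delta; congr (_ + _).
    rewrite {1}(matrix_sum_delta S) exchange_big; apply: eq_bigr => i _.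
    by apply: eq_bigr => j _; rewrite -{1}symS mxE.
  by move=> i _; rewrite -big_split; apply: eq_bigr => j _; rewrite /= -scalerDr.
rewrite -[G _]/(L _) linearZ; apply: PZ; rewrite linear_sum; apply: Psum => i.
by rewrite linear_sum; apply: Psum => j; rewrite linearZ; apply: PZ.
Qed.

(** The first row of [gl_(n+1)] comes from [sl2_h] and the [xk], the first column from
    [[yk k, sl2_f]]; their brackets fill [gl_(n+1)], which then spreads [sl2_e] and [sl2_f] over all
    symmetric matrices. *)
Lemma sp_generated X : in_sp X -> P X.
Proof.
rewrite -(submxK X) => /in_sp_block[-> symB symC].
have -> : forall M S T, block_mx M S T (- M^T) = spA M + (spB S + spC T).
  by move=> M S T; rewrite /spA /spB /spC !add_block_mx !addr0 !add0r.
apply: PD (PA _) (PD _ _); apply: Psym => //.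
- exact: spB_linear.
- by move=> M S PS; rewrite -brAB; apply: closedP.2.
- exact: spC_linear.
(* [spC] carries the dual action, so [M] is replaced by [- M^T]. *)
move=> M S PS; have := closedP.2 _ _ (PA (- M^T)) PS.
by rewrite brAC linearN /= trmxK mulNmx mulmxN -opprD opprK.
Qed.

End Generation.
End Symplectic.

(** * Representations: Schur's lemma and the eigenbasis of [sl2_h] *)

Section Representations.
Context {n m : nat}.
Implicit Types (sigma : Mat n -> 'M[CC]_m) (X Y : Mat n) (U Q S : 'M[CC]_m).

(* Turns the action on columns into an action on rows: [invariant U (rho X)]
   becomes [stablemx U (sigma X)]. *)
Lemma dual_rep sigma : is_sp_rep sigma -> is_sp_rep (fun X => - (sigma X)^T).
Proof.
move=> [linS brS]; split=> [a X Y hX hY|X Y hX hY].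
  by rewrite linS // linearP /= opprD scalerN.
by rewrite brS // /lie_br linearB /= !trmx_mul !mulNmx !mulmxN !opprK opprB.
Qed.

Lemma conj_rep sigma S : S \in unitmx -> is_sp_rep sigma ->
  is_sp_rep (fun X => S *m sigma X *m invmx S).
Proof.
move=> uS [linS brS]; split=> [a X Y hX hY|X Y hX hY].
  by rewrite linS // mulmxDr mulmxDl -scalemxAr -scalemxAl.
by rewrite brS // /lie_br mulmxBr mulmxBl !mulmxA !(mulmxKV uS).
Qed.

Lemma rep_scale sigma a X : is_sp_rep sigma -> in_sp X ->
  sigma (a *: X) = (a%:C)%C *: sigma X.
Proof.
move=> [linS _] hX.
have h0 : in_sp (0 : Mat n).
  by have := in_sp_lie_closed.1 (-1) X X hX hX; rewrite scaleN1r addNr.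
have s0 : sigma 0 = 0.
  have := linS 1 0 0 h0 h0; rewrite scaler0 addr0 scale1r => /eqP.
  by rewrite -subr_eq0 opprD addNKr oppr_eq0 => /eqP.
by rewrite -[a *: X]addr0 linS // s0 addr0.
Qed.

Definition row_irreducible sigma := forall U,
  (forall X, in_sp X -> stablemx U (sigma X)) -> U = 0 \/ row_full U.

Lemma dual_irreducible sigma : irreducible_rep sigma ->
  row_irreducible (fun X => - (sigma X)^T).
Proof.
move=> [_ irr] U stU; case: (irr U) => [X hX|/eqmx0P ->|]; [|by left|].
  by have := stU X hX; rewrite mulmxN eqmx_opp.
by rewrite -sub1mx => /andP[_]; right.
Qed.

(** A basis of [s] made of weight vectors of [ad sl2_h], with [zz n] replaced by its half
    [sl2_e]. *)
Definition generator X := [\/ exists k, X = xk k, exists k, X = yk k | X = sl2_e].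

Lemma generator_sp X : generator X -> in_sp X.
Proof.
by case=> [[k ->]|[k ->]|->]; [apply: in_sp_x|apply: in_sp_y|apply: in_sp_e].
Qed.

Lemma generator_weight X : generator X -> exists a, lie_brR sl2_h X = a *: X.
Proof.
case=> [[k ->]|[k ->]|->].
- by exists 1; rewrite sl2_hx scale1r.
- by exists 1; rewrite sl2_hy scale1r.
- by exists 2; rewrite sl2_he.
Qed.

Lemma generator_s X : generator X -> in_s X.
Proof.
case=> [[k ->]|[k ->]|->].
- exists (fun i => (i == k)%:R), (fun=> 0), 0.
  rewrite (bigD1 k) //= big1 => [|i /negPf ->]; last by rewrite !scale0r addr0.
  by rewrite eqxx scale1r !scale0r !addr0.
- exists (fun=> 0), (fun i => (i == k)%:R), 0.
  rewrite (bigD1 k) //= big1 => [|i /negPf ->]; last by rewrite !scale0r addr0.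
  by rewrite eqxx scale1r !scale0r !addr0 add0r.
- exists (fun=> 0), (fun=> 0), 2^-1.
  rewrite big1 => [|i _]; last by rewrite !scale0r addr0.
  by rewrite add0r zzE scalerA mulVf ?pnatr_eq0 // scale1r.
Qed.

Lemma sp_generator_ind (P : Mat n -> Prop) : lie_closed P ->
  (forall X, generator X -> P X) -> P sl2_f -> forall X, in_sp X -> P X.
Proof.
move=> clP gP Pf; apply: sp_generated => // [k|k|]; apply: gP.
- by apply: Or31; exists k.
- by apply: Or32; exists k.
- exact: Or33.
Qed.

Lemma stable_generated sigma U : is_sp_rep sigma ->
  (forall X, generator X -> stablemx U (sigma X)) ->
  stablemx U (sigma sl2_f) -> forall X, in_sp X -> stablemx U (sigma X).
Proof.
move=> [linS brS] gU fU X hX.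
(* Membership in [sp] is carried through the induction because [sigma] is linear and respects
   brackets only there. *)
suff [] : in_sp X /\ stablemx U (sigma X) by [].
move: X {hX} (hX); apply: sp_generator_ind => [|X gX|]; last 2 first.
- by split; [apply: generator_sp | apply: gU].
- by split; [apply: in_sp_f |].
have [cl1 cl2] := @in_sp_lie_closed n.
split=> [a X Y [hX sX] [hY sY]|X Y [hX sX] [hY sY]]; split; auto.
  by rewrite linS // mulmxDr -scalemxAr addmx_sub // scalemx_sub.
rewrite brS // /lie_br mulmxBr !mulmxA addmx_sub //.
  exact: submx_trans (submxMr _ sX) sY.
by rewrite eqmx_opp; apply: submx_trans (submxMr _ sY) sX.
Qed.

Lemma commute_generated sigma Q : is_sp_rep sigma ->
  (forall X, generator X -> Q *m sigma X = sigma X *m Q) ->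
  Q *m sigma sl2_f = sigma sl2_f *m Q ->
  forall X, in_sp X -> Q *m sigma X = sigma X *m Q.
Proof.
move=> [linS brS] gQ fQ X hX.
suff [] : in_sp X /\ Q *m sigma X = sigma X *m Q by [].
move: X {hX} (hX); apply: sp_generator_ind => [|X gX|]; last 2 first.
- by split; [apply: generator_sp | apply: gQ].
- by split; [apply: in_sp_f |].
have [cl1 cl2] := @in_sp_lie_closed n.
split=> [a X Y [hX sX] [hY sY]|X Y [hX sX] [hY sY]]; split; auto.
  by rewrite linS // mulmxDr mulmxDl -scalemxAr -scalemxAl sX sY.
by rewrite brS // /lie_br mulmxBr mulmxBl !mulmxA sX sY -!mulmxA sX sY.
Qed.

Lemma schur sigma Q : (0 < m)%N -> row_irreducible sigma ->
  (forall X, in_sp X -> Q *m sigma X = sigma X *m Q) -> is_scalar_mx Q.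
Proof.
move=> m0 irr QX; have [a ea] := eigenvalue_closed Q m0.
have [X hX|E0|Efull] := irr (eigenspace Q a).
- by apply/eigenspaceP; rewrite -mulmxA -QX // mulmxA (eigenspaceP (submx_refl _)) -scalemxAl.
- by rewrite /eigenvalue E0 eqxx in ea.
apply/is_scalar_mxP; exists a; apply: (row_full_inj Efull).
by rewrite (eigenspaceP (submx_refl _)) mul_mx_scalar.
Qed.

(** Eigenvectors are rows acted on from the right, hence the shift by [- kappa] rather than
    [kappa]. *)
Lemma eigenspace_shift (H A : 'M[CC]_m) (r kappa : CC) :
  mxbr H A = kappa *: A ->
  (eigenspace H r *m A <= eigenspace H (r - kappa))%MS.
Proof.
move=> HA; apply/eigenspaceP.
have -> : eigenspace H r *m A *m H = eigenspace H r *m (H *m A - mxbr H A).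
  by rewrite /mxbr subKr mulmxA.
rewrite HA mulmxBr mulmxA (eigenspaceP (submx_refl _)).
by rewrite -scalemxAl -scalemxAr scalerBl.
Qed.

(** The sum of the eigenspaces of [sl2_h] is nonzero over [CC] and stable under all weight vectors,
    hence under [sp]; by irreducibility it is the whole space. *)
Lemma sl2_h_diagonalizable sigma : (0 < m)%N -> is_sp_rep sigma ->
  row_irreducible sigma ->
  exists2 S, S \in unitmx & exists d, S *m sigma sl2_h *m invmx S = diag_mx d.
Proof.
move=> m0 rep irr; set H := sigma sl2_h.
suff [S uS /diagonalizable_forPex[d /(simmxRL uS) hd]] : diagonalizable H.
  by exists S => //; exists d.
have [rs0 _ hrs] : exists2 rs : seq CC, uniq rs & forall a, eigenvalue H a = (a \in rs).
  have [rs ers] := closed_field_poly_normal (char_poly H).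
  exists (undup rs); rewrite ?undup_uniq // => a.
  rewrite eigenvalue_root_char ers mem_undup (monicP (char_poly_monic H)) scale1r.
  exact: root_prod_XsubC.
pose rs := undup rs0.
apply/diagonalizablePeigen; exists rs; rewrite ?undup_uniq //.
set U := (\sum_(r <- rs) _)%MS.
have subU a : (eigenspace H a <= U)%MS.
  have [->|na] := eqVneq (eigenspace H a) 0; first exact: sub0mx.
  rewrite /U (big_rem a) /= ?addsmxSl // mem_undup -hrs.
  exact: na.
have stU A kappa : mxbr H A = kappa *: A -> stablemx U A.
  move=> HA; rewrite {1}/U; elim/big_rec: _ => [|r V _ sV].
    by rewrite mul0mx sub0mx.
  by rewrite addsmxMr addsmx_sub sV andbT (submx_trans (eigenspace_shift _ HA)).
have wt X a : in_sp X -> lie_brR sl2_h X = a *: X -> stablemx U (sigma X).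
  move=> hX eX; apply: (stU _ (a%:C)%C).
  by rewrite -rep_scale // -eX rep.2 //; apply: in_sp_h.
case: (irr U).
- apply: stable_generated => // [X gX|].
    by have [a] := generator_weight gX; apply: wt; apply: generator_sp.
  by apply: wt sl2_hf; apply: in_sp_f.
- move=> U0; have [a ea] := eigenvalue_closed H m0.
  by have := subU a; rewrite U0 submx0 => /eqP E0; rewrite /eigenvalue E0 eqxx in ea.
- by move=> fU; apply/eqmxP; rewrite submx1 sub1mx.
Qed.

(** Conjugation by [S] passes to an eigenbasis of [sl2_h], where [idempotent_commuting] applies. *)
Lemma idempotent_trivial sigma P : (0 < m)%N -> is_sp_rep sigma ->
  row_irreducible sigma -> P *m P = P ->
  (forall X, generator X -> P *m sigma X = sigma X *m P) -> P = 0 \/ P = 1%:M.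
Proof.
move=> m0 rep irr PP PX.
have [S uS [d Hd]] := sl2_h_diagonalizable m0 rep irr.
pose c A := S *m A *m invmx S.
have cM A B : c A *m c B = c (A *m B) by rewrite /c !mulmxA mulmxKV.
have rep' := conj_rep uS rep.
have brc X Y a : in_sp X -> in_sp Y -> lie_brR X Y = a *: Y ->
    mxbr (c (sigma X)) (c (sigma Y)) = (a%:C)%C *: c (sigma Y).
  by move=> hX hY e; rewrite -(rep_scale _ rep') // -e rep'.2.
have hH : in_sp (sl2_h : Mat n) := in_sp_h.
have hF : in_sp (sl2_f : Mat n) := in_sp_f.
have : c P = 0 \/ c P = 1%:M.
  apply: (@idempotent_commuting _ _ d (c (sigma sl2_e)) (c (sigma sl2_f))
    (fun A => exists2 X, generator X & A = c (sigma X))) => //.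
  - by rewrite -Hd -sl2_ef; rewrite -[LHS](rep'.2 _ _ in_sp_e hF).
  - rewrite -Hd (brc _ _ _ hH hF sl2_hf).
    by rewrite rmorphN rmorph_nat.
  - by exists sl2_e => //; apply: Or33.
  - move=> _ [X gX ->]; have [a ea] := generator_weight gX.
    by exists (a%:C)%C; rewrite -Hd; apply: brc => //; apply: generator_sp.
  - move=> Q QN Qf.
    have [Q' Qe] : exists Q', Q = c Q'.
      by exists (invmx S *m Q *m S); rewrite /c !mulmxA mulmxV // mul1mx mulmxK.
    have /(schur m0 irr)/is_scalar_mxP[a ea] : forall X, in_sp X ->
        Q' *m sigma X = sigma X *m Q'.
      have cinj A B : c A = c B -> A = B.
        move=> /(congr1 (fun M => invmx S *m M *m S)).
        by rewrite /c !mulmxA !mulmxKV // mulVmx // !mul1mx.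
      apply: commute_generated => // [X gX|]; apply: cinj; rewrite -!cM -Qe //.
      by apply: QN; exists X.
    apply/is_scalar_mxP; exists a; rewrite Qe ea /c mul_mx_scalar -scalemxAl.
    by rewrite mulmxV // scalemx1.
  - by rewrite cM PP.
  - by move=> _ [X gX ->]; rewrite !cM PX.
case=> /(congr1 (fun M => invmx S *m M *m S)).
  by rewrite /c !mulmxA mulmxKV // mulVmx // mul1mx mulmx0 mul0mx; left.
by rewrite /c !mulmxA mulmxKV // mulVmx // mul1mx mulmx1 mulVmx //; right.
Qed.

End Representations.

(** * From a decomposition over [s] to a commuting projection *)

Theorem mainTheorem5 (n : nat) (hn : (1 <= n)%nat) (m : nat)
    (rho : Mat n -> 'M[CC]_m) :
  is_sp_rep rho -> irreducible_rep rho -> indecomposable_on_s rho.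
Proof.
move=> rep irr; have m0 := irr.1; split=> // U W invU invW UW0 UW1.
have capUW : (U :&: W = 0)%MS by apply/eqP; rewrite -submx0; case/andP: UW0.
have sumUW A : (A <= U + W)%MS by apply: submx_full; rewrite -sub1mx; case/andP: UW1.
pose sigma X := - (rho X)^T.
have stable (V : 'M_m) X : Defs.invariant V (rho X) -> stablemx V (sigma X).
  by rewrite /Defs.invariant /sigma mulmxN eqmx_opp.
pose P := proj_mx U W.
have Pcomm X : generator X -> P *m sigma X = sigma X *m P.
  move=> gX; have sX := generator_s gX.
  (* Insert the identity as the sum of both projections: [sigma X] keeps the [W]-part in [W], where
     [P] kills it, and the [U]-part in [U], where [P] fixes it. *)
  have -> : sigma X *m P = (P + proj_mx W U) *m sigma X *m P.
    by have := add_proj_mx capUW (sumUW _ 1%:M); rewrite !mul1mx => ->; rewrite mul1mx.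
  rewrite mulmxDl mulmxDl [X in _ + X]proj_mx_0 ?addr0 //.
    rewrite proj_mx_id //; apply: submx_trans (stable _ _ (invU _ sX)).
    by apply: submxMr; rewrite -[P]mul1mx proj_mx_sub.
  apply: submx_trans (stable _ _ (invW _ sX)).
  by apply: submxMr; rewrite -[proj_mx W U]mul1mx proj_mx_sub.
have [P0|P1] : P = 0 \/ P = 1%:M.
- apply: (idempotent_trivial (sigma := sigma)) => //; first exact: dual_rep.
  + exact: dual_irreducible.
  + exact: proj_mx_proj.
- left; rewrite -(proj_mx_id capUW (submx_refl U)) -/P P0 mulmx0.
  by rewrite submx_refl.
- right; rewrite -[W]mulmx1 -P1 /P (proj_mx_0 capUW (submx_refl W)).
  by rewrite submx_refl.
Qed.
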